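(* Let $0<\alpha<1$, $\sigma>0$, $N_1$ a positive integer, $h=\sigma^2\alpha^2$, $T=\sqrt{N_1h}=\sigma\alpha\sqrt{N_1}$, $\kappa=\frac{\alpha}{1-\alpha}$, and $N_t=\mathrm{ceil}\big((\kappa+1)^2T^2/h+1\big)$. For $x\in[0,1]$ and $u>0$ let $$f(u,x)=\frac{\sin(\alpha\pi)}{\alpha\pi}\frac{1}{2\sqrt u}\frac{xe^{\sqrt u-T}}{e^{\frac1\alpha(\sqrt u-T)}+x},\quad I(x)=\int_0^{N_th}f(u,x)\,\mathrm{d}u,\quad S(x)=h\sum_{j=1}^{N_t}f(jh,x).$$ Let $$u^*=\frac{1+(1-2\alpha)\sqrt{4\alpha-4\alpha^2+1}}{2(1-\alpha)^2},\qquad x^*=\frac{\frac1\kappa\sqrt{u^*}+1}{\sqrt{u^*}-1}\,e^{\frac1\alpha(\sqrt{u^*}-T)}.$$ Then uniformly for $x\in[0,x^*]$, $$0\le I(x)-S(x)\le I(x)\le\left(\frac{\frac1\kappa\sqrt{u^*}+1}{\sqrt{u^*}-1}\right)^{\alpha}e^{\sqrt{u^*}-T}.$$ Additionally, $u^*$ is monotonically increasing in $\alpha\in(0,1)$ with $u^*\in(1,4)$, and $\left(\frac{\frac1\kappa\sqrt{u^*}+1}{\sqrt{u^*}-1}\right)^{\alpha}e^{\sqrt{u^*}}$ is uniformly bounded for $\alpha\in(0,1)$.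
   Context: $\mathrm{ceil}(y)$ denotes the least integer $\ge y$. *)

(* Defs.v *)
From HB Require Import structures.
From mathcomp Require Import all_boot all_order all_algebra.
From mathcomp Require Import all_classical all_reals all_analysis.
Set Implicit Arguments. Unset Strict Implicit. Unset Printing Implicit Defensive.
Import Order.TTheory GRing.Theory Num.Theory.
Import numFieldNormedType.Exports.
Local Open Scope classical_set_scope.
Local Open Scope ring_scope.

Section Defs.
Variable R : realType.
Implicit Types (alpha sigma u x : R).

Definition hstep sigma alpha : R := sigma ^+ 2 * alpha ^+ 2.
Definition Tend sigma alpha (N1 : nat) : R := Num.sqrt (N1%:R * hstep sigma alpha).
Definition kappa alpha : R := alpha / (1 - alpha).
(* N_t = ceil((kappa+1)^2 T^2/h + 1), a positive integer, taken as a nat *)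
Definition Nt sigma alpha (N1 : nat) : nat :=
  `| Num.ceil ((kappa alpha + 1) ^+ 2 * (Tend sigma alpha N1) ^+ 2
                / hstep sigma alpha + 1) |%N.

Definition fint sigma alpha (N1 : nat) u x : R :=
  sin (alpha * pi) / (alpha * pi) * (1 / (2 * Num.sqrt u)) *
  ((x * expR (Num.sqrt u - Tend sigma alpha N1)) /
   (expR ((Num.sqrt u - Tend sigma alpha N1) / alpha) + x)).

Definition Iint sigma alpha (N1 : nat) x : \bar R :=
  (\int[lebesgue_measure]_(u in `]0%R, ((Nt sigma alpha N1)%:R * hstep sigma alpha)%R])
      (fint sigma alpha N1 u x)%:E)%E.

Definition Ssum sigma alpha (N1 : nat) x : R :=
  hstep sigma alpha *
  \sum_(1 <= j < (Nt sigma alpha N1).+1)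
     fint sigma alpha N1 (j%:R * hstep sigma alpha) x.

Definition ustar alpha : R :=
  (1 + (1 - 2 * alpha) * Num.sqrt (4 * alpha - 4 * alpha ^+ 2 + 1))
  / (2 * (1 - alpha) ^+ 2).

Definition Cratio alpha : R :=
  ((1 / kappa alpha) * Num.sqrt (ustar alpha) + 1) / (Num.sqrt (ustar alpha) - 1).

Definition xstar sigma alpha (N1 : nat) : R :=
  Cratio alpha * expR ((Num.sqrt (ustar alpha) - Tend sigma alpha N1) / alpha).

Definition Ibound sigma alpha (N1 : nat) : R :=
  (Cratio alpha) `^ alpha * expR (Num.sqrt (ustar alpha) - Tend sigma alpha N1).

End Defs.

(* Main.v *)
Require Import Defs.
From HB Require Import structures.
From mathcomp Require Import all_boot all_order all_algebra.
From mathcomp Require Import all_classical all_reals all_analysis.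
From mathcomp Require Import measurable_realfun ring lra.
Set Implicit Arguments. Unset Strict Implicit. Unset Printing Implicit Defensive.
Import Order.TTheory GRing.Theory Num.Theory.
Import numFieldNormedType.Exports.
Local Open Scope classical_set_scope.
Local Open Scope ring_scope.

(* Monotonicity in u: with w = sqrt u* - 1 one has alpha (1 + w^2) = w (1 + w) and
   C = 1 / w^2, and x <= x* is exactly what makes u |-> f(u, x) nonincreasing, since
   x* is the minimum over v > 1 of the threshold (v / kappa + 1) e^((v - T) / alpha) / (v - 1).
   Hence S(x) is a lower Riemann sum of I(x).

   Upper bound: up to the factor sin(alpha pi) x^alpha / pi, I(x) is part of the
   Beta integral of t^(alpha - 1) / (1 + t) over (0, oo), so the bound x^alpha is the
   inequality "Beta integral <= pi / sin(alpha pi)". It is proved by bounding both sides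
   by the same partial product of (1 - alpha^2 / k^2): for the sine through the integrals
   of cos(2 alpha t) cos(t)^(2n) over [0, pi/2], for the Beta integral through the
   recurrence in y for the integrals of t^(alpha - 1) / (1 + t)^y. *)

(** * The constants [ustar] and [Cratio], made rational through w = sqrt u* - 1 *)

Section Ustar.
Variable R : realType.
Implicit Types alpha : R.

(** With s the inner root, s^2 = 4 alpha - 4 alpha^2 + 1 turns the numerator of [ustar] into (1 - 2
    alpha + s)^2 / 2. *)
Lemma sqrt_ustarE alpha : 0 < alpha < 1 ->
  Num.sqrt (ustar alpha) =
  (1 - 2 * alpha + Num.sqrt (4 * alpha - 4 * alpha ^+ 2 + 1)) / (2 * (1 - alpha)).
Proof.
move=> /andP[a0 a1]; rewrite /ustar.
set d := 4 * alpha - 4 * alpha ^+ 2 + 1.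
have d1 : 1 < d by rewrite /d; nra.
set s := Num.sqrt d.
have ss : s ^+ 2 = d by rewrite sqr_sqrtr//; lra.
have s1 : 1 < s by rewrite -sqrtr1 ltr_sqrt//; lra.
have -> : (1 + (1 - 2 * alpha) * s) / (2 * (1 - alpha) ^+ 2) =
          ((1 - 2 * alpha + s) / (2 * (1 - alpha))) ^+ 2.
  have -> : 1 + (1 - 2 * alpha) * s = (1 - 2 * alpha + s) ^+ 2 / 2.
    by rewrite sqrrD ss /d; field.
  by field; lra.
by rewrite sqrtr_sqr ger0_norm// divr_ge0//; lra.
Qed.

(** w is the positive root of (1 - alpha) w^2 + w - alpha, whose discriminant is the radicand in
    [ustar]. Solving for alpha instead makes the later constants rational in w. *)
Lemma sqrt_ustar_root alpha : 0 < alpha < 1 ->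
  let w := Num.sqrt (ustar alpha) - 1 in
  [/\ 0 < w, w < 1 & alpha * (1 + w ^+ 2) = w * (1 + w)].
Proof.
move=> /[dup] aI /andP[a0 a1] /=; rewrite sqrt_ustarE//.
set d := 4 * alpha - 4 * alpha ^+ 2 + 1.
have d1 : 1 < d by rewrite /d; nra.
set s := Num.sqrt d.
have ss : s ^+ 2 = d by rewrite sqr_sqrtr//; lra.
have s1 : 1 < s by rewrite -sqrtr1 ltr_sqrt//; lra.
have -> : (1 - 2 * alpha + s) / (2 * (1 - alpha)) - 1 = (s - 1) / (2 * (1 - alpha)).
  by field; lra.
split.
- by rewrite divr_gt0//; lra.
- by rewrite ltr_pdivrMr ?mul1r; [rewrite /d in ss; nra|lra].
- apply/eqP; rewrite -subr_eq0; apply/eqP.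
  have -> : alpha * (1 + ((s - 1) / (2 * (1 - alpha))) ^+ 2) -
     (s - 1) / (2 * (1 - alpha)) * (1 + (s - 1) / (2 * (1 - alpha))) =
     (d - s ^+ 2) / (4 * (1 - alpha)) by rewrite /d; field; lra.
  by rewrite ss subrr mul0r.
Qed.

Lemma ustar_gt0 alpha : 0 < alpha < 1 -> 0 < ustar alpha.
Proof.
(* [Num.sqrt] is 0 on nonpositive reals, which would give w = -1. *)
move=> /sqrt_ustar_root[w0 _ _]; rewrite ltNge; apply/negP => /ler0_sqrtr u0.
by rewrite u0 in w0; lra.
Qed.

Lemma ustar_sqr alpha : 0 < alpha < 1 -> ustar alpha = Num.sqrt (ustar alpha) ^+ 2.
Proof. by move=> /ustar_gt0/ltW u0; rewrite sqr_sqrtr. Qed.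

Lemma ustar_bounds alpha : 0 < alpha < 1 -> 1 < ustar alpha < 4.
Proof.
move=> /[dup] aI /sqrt_ustar_root[w0 w1 _].
by rewrite (ustar_sqr aI); apply/andP; split; nra.
Qed.

(* alpha = w (1 + w) / (1 + w^2) is increasing in w = sqrt u* - 1. *)
Lemma ustar_increasing : {in `]0, 1[ &, {homo (@ustar R) : a b / a < b}}.
Proof.
move=> a b; rewrite !in_itv/= => aI bI ab.
have [] := sqrt_ustar_root aI; have [] := sqrt_ustar_root bI.
rewrite (ustar_sqr aI) (ustar_sqr bI) ltr_pXn2r ?nnegrE ?sqrtr_ge0// -!ustar_sqr//.
set v := Num.sqrt (ustar a); set w := Num.sqrt (ustar b).
have -> : v = (v - 1) + 1 by ring.
have -> : w = (w - 1) + 1 by ring.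
rewrite !addrK; move: (v - 1) (w - 1) => {}v {}w w0 w1 bE v0 v1 aE.
rewrite ltrD2r ltNge; apply/negP => wv.
have : (b - a) * ((1 + v ^+ 2) * (1 + w ^+ 2)) = (w - v) * (1 + v + w - v * w).
  transitivity (b * (1 + w ^+ 2) * (1 + v ^+ 2) - a * (1 + v ^+ 2) * (1 + w ^+ 2)).
    by ring.
  by rewrite aE bE; ring.
have : 0 < (b - a) * ((1 + v ^+ 2) * (1 + w ^+ 2)).
  by rewrite !mulr_gt0//; nra.
have : (w - v) * (1 + v + w - v * w) <= 0 by rewrite mulr_le0_ge0//; nra.
lra.
Qed.

(** Here 1 / kappa = (1 - w) / (w (1 + w)), so the numerator of [Cratio] is (1 - w) / w + 1 = 1 /
    w. *)
Lemma CratioE alpha : 0 < alpha < 1 ->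
  Cratio alpha = ((Num.sqrt (ustar alpha) - 1) ^+ 2)^-1.
Proof.
move=> /[dup] aI /andP[a0 a1]; have := sqrt_ustar_root aI; rewrite /Cratio/kappa/=.
set v := Num.sqrt _; move=> [w0 w1 aE].
have -> : v = (v - 1) + 1 by ring.
rewrite addrK; move: (v - 1) w0 w1 aE => {v} w w0 w1 aE.
have -> : alpha = w * (1 + w) / (1 + w ^+ 2) by rewrite -aE mulfK//; nra.
have n1 : 1 + w ^+ 2 != 0 by rewrite gt_eqF//; nra.
have n2 : 1 + w ^+ 2 - w * (1 + w) != 0 by rewrite gt_eqF//; nra.
by field; rewrite n1 n2; rewrite !gt_eqF//; nra.
Qed.

Lemma Cratio_gt0 alpha : 0 < alpha < 1 -> 0 < Cratio alpha.
Proof.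
move=> aI; rewrite CratioE// invr_gt0 exprn_gt0//.
by have [] := sqrt_ustar_root aI.
Qed.

(* alpha <= 2w and C = 1/w^2, so alpha ln C <= 2 w (2 / w). *)
Lemma Cratio_powR_le alpha : 0 < alpha < 1 ->
  `|(Cratio alpha) `^ alpha * expR (Num.sqrt (ustar alpha))| <= expR 6.
Proof.
move=> /[dup] aI /andP[a0 a1].
rewrite ger0_norm ?mulr_ge0 ?powR_ge0 ?expR_ge0//.
rewrite /powR gt_eqF ?Cratio_gt0// -expRD ler_expR CratioE//.
have := sqrt_ustar_root aI => /=.
set w := _ - 1; move=> [w0 w1 aE].
have aw : alpha <= 2 * w by nra.
have -> : Num.sqrt (ustar alpha) = w + 1 by rewrite /w; ring.
have iw : 1 < w^-1 by rewrite invf_gt1.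
rewrite -exprVn lnXn ?invr_gt0// -mulr_natl.
have l0 : 0 < ln w^-1 by rewrite ln_gt0.
have l1 : w * ln w^-1 < 1.
  by rewrite -ltr_pdivlMl// mulr1 ln_sublinear// invr_gt0.
(* The exponent is at most (2 w) (2 l) + w + 1; w l < 1 and w < 1 bound it by 4 + 2 = 6. *)
by move: (ln _) l0 l1 => l l0 l1; nra.
Qed.

(* The tangent line of exp at 0 reduces the minimality of x* to the identity
   (k v + 1)(1 + (v - r) / alpha) - C (v - 1) = (k / alpha) (v - r)^2,
   with r = sqrt u* and k = 1 / kappa. *)
Lemma Cratio_min alpha v : 0 < alpha < 1 -> 0 < v ->
  Cratio alpha * (v - 1) <=
  ((alpha^-1 - 1) * v + 1) * expR ((v - Num.sqrt (ustar alpha)) / alpha).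
Proof.
move=> /[dup] aI /andP[a0 a1] v0; rewrite CratioE//.
have := sqrt_ustar_root aI => /=.
set w := _ - 1; move=> [w0 w1 aE].
have -> : Num.sqrt (ustar alpha) = w + 1 by rewrite /w; ring.
have k0 : 0 < alpha^-1 - 1 by rewrite subr_gt0 invf_gt1.
apply: (@le_trans _ _ (((alpha^-1 - 1) * v + 1) * (1 + (v - (w + 1)) / alpha))).
  rewrite -subr_ge0.
  have -> : ((alpha^-1 - 1) * v + 1) * (1 + (v - (w + 1)) / alpha) - (w ^+ 2)^-1 * (v - 1)
    = (alpha^-1 - 1) / alpha * (v - (w + 1)) ^+ 2.
    have -> : alpha = w * (1 + w) / (1 + w ^+ 2) by rewrite -aE mulfK//; nra.
    have n1 : 1 + w ^+ 2 != 0 by rewrite gt_eqF//; nra.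
    by field; rewrite n1; rewrite !gt_eqF//; nra.
  by rewrite mulr_ge0 ?sqr_ge0// divr_ge0// ltW.
by rewrite ler_wpM2l// ?expR_ge1Dx//; nra.
Qed.
End Ustar.

(** * Differentiation rules for explicit functions, and monotonicity *)

Section Derivatives.
Variable R : realType.
Implicit Types (a t x y df dg : R) (f g G : R -> R).

Lemma is_derive1M f g x df dg : is_derive x 1 f df -> is_derive x 1 g dg ->
  is_derive x 1 (fun t => f t * g t) (f x * dg + df * g x).
Proof.
move=> dfx dgx; rewrite (_ : (fun t => f t * g t) = f * g)//; apply: is_derive_eq.
by rewrite /GRing.scale/= [g x * _]mulrC.
Qed.

Lemma is_derive1D f g x df dg : is_derive x 1 f df -> is_derive x 1 g dg ->
  is_derive x 1 (fun t => f t + g t) (df + dg).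
Proof. by move=> dfx dgx; exact: (is_deriveD dfx dgx). Qed.

Lemma is_derive1B f g x df dg : is_derive x 1 f df -> is_derive x 1 g dg ->
  is_derive x 1 (fun t => f t - g t) (df - dg).
Proof. by move=> dfx dgx; exact: (is_deriveB dfx dgx). Qed.

Lemma is_derive1Zl a f x df : is_derive x 1 f df ->
  is_derive x 1 (fun t => a * f t) (a * df).
Proof. by move=> dfx; exact: (is_deriveZ a dfx). Qed.

(** Stands in for the monotonicity of the integral: increments of antiderivatives are compared
    directly. *)
Lemma is_derive_ge0_le G g x y : x <= y ->
  (forall t, x <= t <= y -> is_derive t 1 G (g t)) ->
  (forall t, x <= t <= y -> 0 <= g t) -> G x <= G y.
Proof.
move=> xy dG g0.
have oc t : t \in `]x, y[%R -> x <= t <= y.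
  by rewrite in_itv/= => /andP[/ltW-> /ltW->].
apply: (@ger0_derive1_ndecr R G x y) => //.
- by move=> t /oc/dG [].
- by move=> t /oc tI; rewrite derive1E (@derive_val _ _ _ _ _ _ _ (dG t tI)) g0.
- apply: derivable_within_continuous => t; rewrite in_itv/= => tI.
  by have [] := dG t tI.
Qed.

End Derivatives.

(** * The sine bounded above by the partial products of its Euler product *)

Section Sine.
Variable R : realType.
Implicit Types (a t : R) (G : R -> R).

Lemma is_derive_cosZ a t :
  is_derive t 1 (fun t => cos (a * t)) (- (a * sin (a * t))).
Proof. by apply: is_derive_eq; rewrite /GRing.scale/=; ring. Qed.

Lemma is_derive_sinZ a t :
  is_derive t 1 (fun t => sin (a * t)) (a * cos (a * t)).
Proof. by apply: is_derive_eq; rewrite /GRing.scale/=; ring. Qed.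

Lemma is_derive_cosX n t :
  is_derive t 1 (fun t => cos t ^+ n) (- (n%:R * cos t ^+ n.-1 * sin t)).
Proof.
have := is_deriveX n (is_derive_cos t).
by rewrite exprfctE /GRing.scale/= mulrN.
Qed.

(* Integral of cos(2at) cos^(2n) t over [0, pi/2], through antiderivatives; the
   recurrence in n comes from the boundary term
   m cos(2at) cos^(m-1) t sin t - 2a sin(2at) cos^m t with m = 2n. *)
Lemma cosZ_cosX_antiderivative a G0 : 0 <= a < 1 ->
  (forall t, is_derive t 1 G0 (cos (2 * a * t))) ->
  forall n : nat, exists2 G,
  forall t, is_derive t 1 G (cos (2 * a * t) * cos t ^+ n.*2) &
  G (pi / 2) - G 0 = (G0 (pi / 2) - G0 0) *
  \prod_(1 <= k < n.+1) ((2 * k%:R * (2 * k%:R - 1)) / (4 * k%:R ^+ 2 - 4 * a ^+ 2)).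
Proof.
move=> /andP[a0 a1] dG0; elim=> [|n [G dG GE]].
  exists G0; first by move=> t; rewrite expr0 mulr1.
  by rewrite big_geq// mulr1.
set d : R := 4 * n.+1%:R ^+ 2 - 4 * a ^+ 2.
have d0 : d != 0.
  rewrite /d; have : 1 <= n.+1%:R :> R by rewrite ler1n.
  by move: (n.+1%:R) => k k1; rewrite gt_eqF//; nra.
set m : R := 2 * n.+1%:R.
pose B t := m * (cos (2 * a * t) * (cos t ^+ n.*2.+1 * sin t))
            - 2 * a * (sin (2 * a * t) * cos t ^+ n.*2.+2).
exists (fun t => d^-1 * (B t + m * (m - 1) * G t)).
  move=> t.
  have d1 := is_derive1M (is_derive_cosZ (2 * a) t)
    (is_derive1M (is_derive_cosX n.*2.+1 t) (is_derive_sin t)).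
  have d2 := is_derive1M (is_derive_sinZ (2 * a) t) (is_derive_cosX n.*2.+2 t).
  have d3 := is_derive1Zl d^-1 (is_derive1D
    (is_derive1B (is_derive1Zl m d1) (is_derive1Zl (2 * a) d2))
    (is_derive1Zl (m * (m - 1)) (dG t))).
  apply: (is_derive_eq d3) => {d1 d2 d3}.
  have -> : n.*2.+2%:R = m :> R by rewrite -doubleS -mul2n natrM.
  have -> : n.*2.+1%:R = m - 1 :> R by rewrite -natr1 /m -mul2n natrM -natr1; ring.
  apply: (mulfI d0); rewrite mulVKf// doubleS /=.
  have dE : d = m ^+ 2 - 4 * a ^+ 2 by rewrite /d /m; ring.
  rewrite !exprS dE.
  have : sin t * sin t = 1 - cos t * cos t by rewrite -(cos2Dsin2 t); ring.
  move: (sin t) (cos t) (cos t ^+ n.*2) (cos (2 * a * t)) (sin (2 * a * t)) => S C X c s SS.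
  transitivity (m * (m - 1) * c * X * (1 - C * C - S * S)
                + (m ^+ 2 - 4 * a ^+ 2) * (c * (C * (C * X)))); first by ring.
  by rewrite SS; ring.
(* [B] vanishes at both ends, since cos (pi / 2) = 0 and sin 0 = 0; this leaves m (m - 1) / d as the
   new factor. *)
rewrite big_nat_recr//= [RHS]mulrA -GE -/m -/d /B cos_pihalf sin0 !mulr0 sin0 !exprS.
by field.
Qed.

(** As cos (2at) <= 1, the integral of cos (2at) cos^(2n) t is at most that of cos^(2n) t.
    Evaluated, this reads sin (a pi) / (2a) P <= (pi / 2) Q, and Q / P is the product of the 1 - a^2
    / k^2. *)
Lemma sin_le_prod a n : 0 < a < 1 ->
  sin (a * pi) <= a * pi * \prod_(1 <= k < n.+1) (1 - a ^+ 2 / k%:R ^+ 2).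
Proof.
move=> /andP[a0 a1].
have [||G dG GE] := @cosZ_cosX_antiderivative a (fun t => (2 * a)^-1 * sin (2 * a * t)) _ _ n.
- by rewrite ltW.
- move=> t; apply: (is_derive_eq (is_derive1Zl _ (is_derive_sinZ _ t))).
  by rewrite mulKf//; lra.
(* The frequency a = 0 gives the Wallis integral; its starting antiderivative is [id], as sin (2at)
   / (2a) degenerates there. *)
have [||H dH HE] := @cosZ_cosX_antiderivative 0 id _ _ n.
- by rewrite lexx ltr01.
- by move=> t; rewrite mulr0 mul0r cos0; exact: is_derive_id.
have HG : H 0 - G 0 <= H (pi / 2) - G (pi / 2).
  apply: (@is_derive_ge0_le _ (fun t => H t - G t)
    (fun t => (1 - cos (2 * a * t)) * cos t ^+ n.*2)) => //.
  - by rewrite divr_ge0// pi_ge0.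
  - move=> t _; apply: (is_derive_eq (is_derive1B (dH t) (dG t))).
    by rewrite mulr0 mul0r cos0; ring.
  - by move=> t _; rewrite mulr_ge0 ?subr_ge0 ?cos_le1// -mul2n exprM exprn_ge0// sqr_ge0.
have {HG} : G (pi / 2) - G 0 <= H (pi / 2) - H 0 by lra.
rewrite GE HE mulr0 sin0 mulr0 !subr0.
have -> : 2 * a * (pi / 2) = a * pi by field.
set P := \prod_(1 <= k < n.+1) (_ / (_ - 4 * a ^+ 2)).
set Q := \prod_(1 <= k < n.+1) (_ / (_ - _)).
set S := \prod_(1 <= k < n.+1) _.
have P0 : 0 < P.
  rewrite /P big_nat prodr_gt0// => k /andP[k1 _].
  have : 1 <= k%:R :> R by rewrite ler1n.
  by move: (k%:R) => {}k {}k1; rewrite divr_gt0//; nra.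
have QE : Q = S * P.
  rewrite /Q /S /P -big_split/= big_nat [RHS]big_nat; apply: eq_bigr => k /andP[k1 _].
  have : 1 <= k%:R :> R by rewrite ler1n.
  by move: (k%:R) => {}k {}k1; field; rewrite !gt_eqF//; nra.
rewrite QE mulrA ler_pM2r// ler_pdivrMl; last lra.
by move=> /le_trans; apply; rewrite le_eqVlt; apply/orP; left; apply/eqP; field.
Qed.
End Sine.

(** * Upper bounds for Beta integrals by a recurrence in the exponent *)

Section BetaKernel.
Variables (R : realType) (a : R).
Hypothesis aI : 0 < a < 1.
Implicit Types (y z C : R) (G g : R -> R).

Definition softplus z : R := ln (1 + expR z).

(* In the variable s = e^z this is s^a (1 + s)^(-y), so that its integral over
   the line is the Beta integral B(a, y - a). *)
Definition beta_kernel y z : R := expR (a * z - y * softplus z).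

Lemma expR_softplus z : expR (softplus z) = 1 + expR z.
Proof. by rewrite /softplus lnK// posrE addr_gt0// expR_gt0. Qed.

Lemma softplus_gt0 z : 0 < softplus z.
Proof. by rewrite /softplus ln_gt0// ltrDl expR_gt0. Qed.

Lemma softplus_gt z : z < softplus z.
Proof. by rewrite -ltr_expR expR_softplus ltrDr. Qed.

Lemma beta_kernel_gt0 y z : 0 < beta_kernel y z.
Proof. exact: expR_gt0. Qed.

Lemma beta_kernelS y z : beta_kernel (y + 1) z = beta_kernel y z / (1 + expR z).
Proof.
rewrite /beta_kernel -expR_softplus -expRN -expRD; congr expR; ring.
Qed.

Lemma beta_kernel_le y y' z : y <= y' -> beta_kernel y' z <= beta_kernel y z.
Proof.
move=> yy'; rewrite ler_expR lerD2l lerN2 ler_wpM2r//.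
exact/ltW/softplus_gt0.
Qed.

(** The derivative of [softplus] is 1 - 1 / (1 + e^z). For a < y the kernel vanishes at both
    infinities, so integrating gives the recurrence (y - a) B(a, y - a) = y B(a, y + 1 - a). *)
Lemma is_derive_beta_kernel y z : is_derive z 1 (beta_kernel y)
  ((a - y) * beta_kernel y z + y * beta_kernel (y + 1) z).
Proof.
have p0 : 0 < 1 + expR z by rewrite addr_gt0// expR_gt0.
have d1 : is_derive z 1 (fun z => 1 + expR z) (expR z).
  by apply: is_derive_eq; rewrite add0r mul1r.
have d2 := @is_derive1_comp _ _ (fun z => 1 + expR z) _ _ _ (is_derive1_ln p0) d1.
have d3 := is_derive1B (is_derive1Zl a (is_derive_id z 1)) (is_derive1Zl y d2).
have d4 := @is_derive1_comp _ _ (fun z => a * z - y * softplus z) _ _ _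
  (is_derive_expR _) d3.
apply: (is_derive_eq d4); rewrite beta_kernelS -/(beta_kernel y z) /=.
rewrite -/(softplus z) -/(beta_kernel y z); field.
by rewrite gt_eqF.
Qed.

Lemma continuous_beta_kernel y : continuous (beta_kernel y).
Proof.
move=> z; apply/differentiable_continuous/derivable1_diffP.
by have [] := is_derive_beta_kernel y z.
Qed.

(* Says, through a dominating antiderivative, that the integral of beta_kernel y
   over the line is at most C. *)
Definition beta_bounded y C := exists G g,
  [/\ forall z, is_derive z 1 G (g z), continuous g,
      forall z, beta_kernel y z <= g z & forall z0 z1, z0 <= z1 -> G z1 - G z0 <= C].

(** At y = a the first term of the derivative drops out, so [beta_kernel a] divided by a is an exact
    antiderivative, with values between 0 and 1 / a. *)
Lemma beta_bounded_base : beta_bounded (a + 1) a^-1.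
Proof.
case/andP: aI => a0 a1.
exists (fun z => a^-1 * beta_kernel a z), (beta_kernel (a + 1)); split.
- move=> z; apply: (is_derive_eq (is_derive1Zl a^-1 (is_derive_beta_kernel a z))).
  by rewrite subrr mul0r add0r mulKf// gt_eqF.
- exact: continuous_beta_kernel.
- by [].
- move=> z0 z1 _; rewrite -mulrBr ler_piMr ?invr_ge0 ?(ltW a0)//.
  apply: (@le_trans _ _ (beta_kernel a z1)).
    by rewrite gerBl ltW// beta_kernel_gt0.
  rewrite -expR0 ler_expR -mulrBr mulr_ge0_le0 ?(ltW a0)// subr_le0.
  exact/ltW/softplus_gt.
Qed.

Lemma beta_bounded_le y y' C : y <= y' -> beta_bounded y C -> beta_bounded y' C.
Proof.
move=> yy' [G [g [dG cg hg GC]]]; exists G, g; split => // z.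
exact: le_trans (beta_kernel_le z yy') (hg z).
Qed.

(** Serves to make the boundary terms of the recurrence arbitrarily small. *)
Lemma expR_tail (D E e : R) : 0 < D -> 0 < E -> 0 < e ->
  exists zz, forall z, z <= zz -> E * expR (D * z) <= e.
Proof.
move=> D0 E0 e0; exists (ln (e / E) / D) => z zz.
rewrite [E * _]mulrC -ler_pdivlMr// -[leRHS]lnK ?posrE ?divr_gt0//.
by rewrite ler_expR [D * _]mulrC -ler_pdivlMr.
Qed.

(** The new antiderivative p G + q [beta_kernel y] is nondecreasing, so its increment over [z0, z1]
    is at most the one over a wider [t0, t1], where the boundary terms cost at most e; then e is
    arbitrary. *)
Lemma beta_bounded_combine G g y y' p q C :
  (forall z, is_derive z 1 G (g z)) -> continuous g ->
  (forall z, beta_kernel y' z <=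
     p * g z + q * ((a - y) * beta_kernel y z + y * beta_kernel (y + 1) z)) ->
  (forall z0 z1 e, z0 <= z1 -> 0 < e -> exists t0 t1, [/\ t0 <= z0, z1 <= t1 &
     p * (G t1 - G t0) + q * (beta_kernel y t1 - beta_kernel y t0) <= C + e]) ->
  beta_bounded y' C.
Proof.
move=> dG cg hg GC.
pose H z := p * G z + q * beta_kernel y z.
pose h z := p * g z + q * ((a - y) * beta_kernel y z + y * beta_kernel (y + 1) z).
have dH z : is_derive z 1 H (h z).
  exact: (is_derive1D (is_derive1Zl p (dG z)) (is_derive1Zl q (is_derive_beta_kernel y z))).
have ndH : {homo H : s t / s <= t}.
  move=> s t st; apply: (is_derive_ge0_le st (fun z _ => dH z)) => z _.
  exact: le_trans (ltW (beta_kernel_gt0 y' z)) (hg z).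
exists H, h; split => //.
  have cM r (f : R -> R) : continuous f -> continuous (fun z => r * f z).
    by move=> cf z; apply: cvgM; [exact: cvg_cst|exact: cf].
  have cD (f f' : R -> R) : continuous f -> continuous f' -> continuous (fun z => f z + f' z).
    by move=> cf cf' z; apply: cvgD; [exact: cf|exact: cf'].
  by apply: (cD); apply: (cM) => //; apply: (cD); apply: (cM); exact: continuous_beta_kernel.
move=> z0 z1 z01; apply/ler_addgt0Pr => e e0.
have [t0 [t1 [t0z z1t Ht]]] := GC z0 z1 e z01 e0.
apply: le_trans (lerB (ndH _ _ z1t) (ndH _ _ t0z)) _.
apply: le_trans Ht; rewrite /H.
move: (G t0) (G t1) (beta_kernel y t0) (beta_kernel y t1) => u0 u1 v0 v1.
by rewrite le_eqVlt; apply/orP; left; apply/eqP; ring.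
Qed.

(** The recurrence solved for the kernel at y. The boundary term to control is at the left end,
    where [beta_kernel y t] <= e^(a t). *)
Lemma beta_bounded_down y C : a < y -> beta_bounded (y + 1) C ->
  beta_bounded y (y / (y - a) * C).
Proof.
case/andP: aI => a0 a1 ay [G [g [dG cg hg GC]]].
have ya0 : 0 < y - a by rewrite subr_gt0.
have y0 : 0 < y by lra.
apply: (@beta_bounded_combine G g y y (y / (y - a)) (- (y - a)^-1)) => //.
  move=> z; apply: (@le_trans _ _ (beta_kernel y z + y / (y - a) * (g z - beta_kernel (y + 1) z))).
    by rewrite lerDl mulr_ge0 ?subr_ge0 ?hg// divr_ge0// ltW.
  by rewrite le_eqVlt; apply/orP; left; apply/eqP; field; lra.
move=> z0 z1 e z01 e0.
have [zz zzE] : exists zz, forall z, z <= zz -> (y - a)^-1 * expR (a * z) <= e.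
  by apply: expR_tail => //; rewrite invr_gt0.
exists (Num.min z0 zz), z1; split; rewrite ?ge_min ?lexx//.
set t := Num.min z0 zz.
have tz : t <= zz by rewrite ge_min lexx orbT.
have tz1 : t <= z1 by rewrite (le_trans _ z01)// ge_min lexx.
apply: lerD.
  by rewrite ler_wpM2l ?GC// divr_ge0// ltW.
apply: (@le_trans _ _ ((y - a)^-1 * beta_kernel y t)).
  rewrite mulNr -mulrN opprB ler_wpM2l ?invr_ge0 ?(ltW ya0)//.
  by rewrite gerBl ltW// beta_kernel_gt0.
apply: le_trans (zzE _ tz); rewrite ler_wpM2l ?invr_ge0 ?(ltW ya0)// ler_expR.
by rewrite gerBl mulr_ge0// ltW// softplus_gt0.
Qed.

(** The recurrence solved for the kernel at y + 1. The boundary term is now at the right end, where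
    [softplus_gt] gives [beta_kernel y t] <= e^(- (y - a) t). *)
Lemma beta_bounded_up y C : a < y -> beta_bounded y C ->
  beta_bounded (y + 1) ((y - a) / y * C).
Proof.
case/andP: aI => a0 a1 ay [G [g [dG cg hg GC]]].
have ya0 : 0 < y - a by rewrite subr_gt0.
have y0 : 0 < y by lra.
apply: (@beta_bounded_combine G g y (y + 1) ((y - a) / y) y^-1) => //.
  move=> z; apply: (@le_trans _ _ (beta_kernel (y + 1) z + (y - a) / y * (g z - beta_kernel y z))).
    by rewrite lerDl mulr_ge0 ?subr_ge0 ?hg// divr_ge0// ltW.
  by rewrite le_eqVlt; apply/orP; left; apply/eqP; field; lra.
move=> z0 z1 e z01 e0.
have [zz zzE] : exists zz, forall z, z <= zz -> y^-1 * expR ((y - a) * z) <= e.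
  by apply: expR_tail => //; rewrite invr_gt0.
exists z0, (Num.max z1 (- zz)); split; rewrite ?le_max ?lexx//.
set t := Num.max z1 (- zz).
have tz : - t <= zz by rewrite lerNl le_max lexx orbT.
have tz0 : z0 <= t by rewrite (le_trans z01)// le_max lexx.
apply: lerD.
  by rewrite ler_wpM2l ?GC// divr_ge0// ltW.
apply: (@le_trans _ _ (y^-1 * beta_kernel y t)).
  rewrite ler_wpM2l ?invr_ge0 ?(ltW y0)//.
  by rewrite gerBl ltW// beta_kernel_gt0.
apply: le_trans (zzE _ tz); rewrite ler_wpM2l ?invr_ge0 ?(ltW y0)// ler_expR.
have := ler_wpM2l (ltW y0) (ltW (softplus_gt t)).
by lra.
Qed.

(* Going up from a + 1 to n + 1 + a, comparing with n + 2, and going down to 1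
   evaluates the Beta integral B(a, 1 - a) up to the factor (n + 1)/(n + 1 - a). *)
Lemma beta_bounded1 n : beta_bounded 1
  (n.+1%:R / (n.+1%:R - a) * (a * \prod_(1 <= k < n.+1) (1 - a ^+ 2 / k%:R ^+ 2))^-1).
Proof.
case/andP: aI => a0 a1.
have up : beta_bounded (n.+1%:R + a) (a^-1 * \prod_(1 <= k < n.+1) (k%:R / (k%:R + a))).
  elim: n => [|m IH]; first by rewrite big_geq// mulr1 addrC; exact: beta_bounded_base.
  have m0 : 0 < m.+1%:R :> R by rewrite ltr0n.
  rewrite big_nat_recr//= mulrA [X in beta_bounded _ X]mulrC -[m.+2%:R]natr1 addrAC.
  have am : a < m.+1%:R + a by rewrite ltrDr.
  by have := beta_bounded_up am IH; rewrite addrK.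
have down m C : beta_bounded (m.+1%:R + 1) C ->
    beta_bounded 1 (C * \prod_(1 <= k < m.+2) (k%:R / (k%:R - a))).
  elim: m C => [|m IH] C bC.
    by rewrite big_nat1 mulrC; apply: beta_bounded_down.
  rewrite big_nat_recr//= [_ * (_ / _)]mulrC mulrA [C * _]mulrC; apply: IH.
  rewrite natr1; apply: beta_bounded_down => //.
  by rewrite (lt_le_trans a1)// ler1n.
have le1 : n.+1%:R + a <= n.+1%:R + 1 by rewrite lerD2l ltW.
suff -> : n.+1%:R / (n.+1%:R - a) * (a * \prod_(1 <= k < n.+1) (1 - a ^+ 2 / k%:R ^+ 2))^-1
    = a^-1 * \prod_(1 <= k < n.+1) (k%:R / (k%:R + a)) *
      \prod_(1 <= k < n.+2) (k%:R / (k%:R - a)).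
  exact: down (beta_bounded_le le1 up).
(* The downward product has one factor more, k = n + 1, which is split off; the others pair up as k
   / (k + a) times k / (k - a), the inverse of 1 - a^2 / k^2. *)
rewrite [in RHS](@big_nat_recr _ _ _ n.+1)//= invfM -prodfV; symmetry.
rewrite [LHS]mulrA [RHS]mulrC; congr (_ * _); rewrite -[LHS]mulrA; congr (_ * _).
rewrite -big_split/= big_nat [RHS]big_nat; apply: eq_bigr => k /andP[k1 _].
have : 1 <= k%:R :> R by rewrite ler1n.
by move: (k%:R) => {}k {}k1; field; rewrite !gt_eqF//; nra.
Qed.

End BetaKernel.

(** * Integrals over ]0, b] of functions that may be singular at 0 *)

Section HalfOpenIntegral.
Variable R : realType.
Notation mu := (@lebesgue_measure R).
Variable f : R -> R.
Hypothesis cf : forall u : R, 0 < u -> {for u, continuous f}.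
Hypothesis f0 : forall u : R, 0 < u -> 0 <= f u.

Lemma continuous_gt0_measurable_fun (A : set R) : measurable A ->
  A `<=` `]0, +oo[ -> measurable_fun A (fun u => (f u)%:E).
Proof.
move=> mA A0; apply/measurable_EFinP; apply: (measurable_funS _ A0) => //.
apply: open_continuous_measurable_fun; first exact: interval_open.
by move=> u; rewrite inE/= in_itv/= andbT => /cf.
Qed.

(** The intervals [1/(n+1), b] exhaust ]0, b]. On each the fundamental theorem applies to the
    majorant g, and monotone convergence passes to the limit. *)
Lemma integral_oc_le_antiderivative (g G : R -> R) (b C : R) : 0 < b ->
  (forall u : R, 0 < u -> is_derive u 1 G (g u)) ->
  (forall u : R, 0 < u -> {for u, continuous g}) ->
  (forall u : R, 0 < u -> f u <= g u) ->
  (forall s t : R, 0 < s -> s <= t -> G t - G s <= C) ->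
  (\int[mu]_(u in `]0%R, b]) (f u)%:E <= C%:E)%E.
Proof.
move=> b0 dG cg fg GC.
rewrite itv_open_bnd_bigcup.
under eq_bigcupr do rewrite add0r.
have pos n : [set` `[n.+1%:R^-1, b]%R] `<=` `]0%R, +oo[%classic.
  move=> u /=; rewrite !in_itv/= andbT => /andP[nu _].
  by rewrite (lt_le_trans _ nu).
pose F (n : nat) : set (measurableTypeR R) := `[n.+1%:R^-1, b]%classic.
have ndF : nondecreasing_seq F.
  move=> m n mn; rewrite subsetEset; apply: subset_itvr.
  by rewrite bnd_simp lef_pV2 ?posrE// ler_nat.
have mF n : measurable (F n) by exact: measurable_itv.
have mf n : measurable_fun (F n) (EFin \o f).
  exact: (continuous_gt0_measurable_fun (mF n) (@pos n)).
have F0 n u : F n u -> (0 <= (EFin \o f) u)%E.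
  by move=> /(pos n)/=; rewrite in_itv/= andbT => u0; rewrite lee_fin f0.
have := @ge0_nondecreasing_set_cvg_integral _ _ R F (EFin \o f) mu ndF mF mf F0.
apply: cvge_le.
near=> n.
have nb : n.+1%:R^-1 < b by near: n; exact: (near_infty_natSinv_lt (PosNum b0)).
have n0 : 0 < n.+1%:R^-1 :> R by rewrite invr_gt0.
have dcG u : 0 < u -> {for u, continuous G}.
  by move=> /dG[dGu _]; exact/differentiable_continuous/derivable1_diffP.
apply: (@le_trans _ _ (\int[mu]_(u in `[(n.+1%:R^-1)%R, b]) (g u)%:E)%E).
  apply: ge0_le_integral => //.
  - move=> u /(pos n)/=; rewrite in_itv/= andbT => u0.
    by rewrite lee_fin f0.
  - apply/measurable_EFinP; apply: (measurable_funS _ (pos n)) => //.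
    apply: open_continuous_measurable_fun; first exact: interval_open.
    by move=> u; rewrite inE/= in_itv/= andbT => /cg.
  - move=> u /(pos n)/=; rewrite in_itv/= andbT => u0.
    by rewrite lee_fin fg.
rewrite (continuous_FTC2 nb _ _ (F := G)).
- by rewrite -EFinB lee_fin GC// ltW.
- apply: continuous_in_subspaceT => u; rewrite inE => /(pos n)/=.
  by rewrite in_itv/= andbT; exact: cg.
- split.
  + by move=> u; rewrite in_itv/= => /andP[nu _]; have [] := dG u (lt_trans n0 nu).
  + exact/cvg_at_right_filter/dcG.
  + exact/cvg_at_left_filter/dcG.
- move=> u; rewrite in_itv/= => /andP[nu _].
  have dGu := dG u (lt_trans n0 nu).
  by rewrite derive1E derive_val.
Unshelve. all: by end_near. Qed.

(** On each cell the integrand is at least its value at the right end, a sample point that also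
    avoids the singularity at 0. *)
Lemma nonincreasing_sum_le_integral (h : R) n : 0 < h ->
  (forall s t : R, 0 < s -> s <= t -> f t <= f s) ->
  ((h * \sum_(1 <= j < n.+1) f (j%:R * h))%:E
     <= \int[mu]_(u in `]0%R, (n%:R * h)%R]) (f u)%:E)%E.
Proof.
move=> h0 nif; elim: n => [|n IH].
  rewrite big_geq// mulr0; apply: integral_ge0 => u /=; rewrite in_itv/= => /andP[u0 _].
  by rewrite lee_fin f0.
have nh : 0 <= n%:R * h by rewrite mulr_ge0// ltW.
have nSh : n%:R * h <= n.+1%:R * h by rewrite ler_wpM2r ?(ltW h0)// ler_nat.
rewrite (@itv_bndbnd_setU _ _ _ (BRight (n%:R * h)))// ?bnd_simp//.
have pos : `]0%R, (n%:R * h)%R] `|` `]n%:R * h, n.+1%:R * h]%classic `<=` `]0%R, +oo[%classic.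
  move=> u [|] /=; rewrite !in_itv/= andbT => /andP[u0 _] //.
  exact: le_lt_trans u0.
rewrite ge0_integral_setU//=; last 3 first.
- apply: continuous_gt0_measurable_fun => //.
  by apply: measurableU => //; exact: measurable_itv.
- by move=> u /pos/=; rewrite in_itv/= andbT => u0; rewrite lee_fin f0.
- apply/disj_set2P; rewrite -subset0 => u [] /=; rewrite !in_itv/= => /andP[_ un] /andP[nu _].
  by move: (le_lt_trans un nu); rewrite ltxx.
rewrite big_nat_recr//= mulrDr EFinD; apply: leeD => //.
apply: (@le_trans _ _ (\int[mu]_(u in `](n%:R * h)%R, (n.+1%:R * h)%R]) (f (n.+1%:R * h)%R)%:E)%E).
  rewrite integral_cst//= lebesgue_measure_itv/= lte_fin ltr_pM2r// ltr_nat ltnSn.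
  by rewrite -EFinB -EFinM lee_fin -mulrBl -natrB// subSnn mul1r mulrC.
have pos2 : `]n%:R * h, n.+1%:R * h]%classic `<=` `]0%R, +oo[%classic.
  by move=> u un; apply: pos; right.
apply: ge0_le_integral => //.
- by move=> u _; rewrite lee_fin f0// mulr_gt0.
- exact: continuous_gt0_measurable_fun.
- move=> u /[dup] /pos2/=; rewrite !in_itv/= andbT => u0 /andP[_ un].
  by rewrite lee_fin nif.
Qed.
End HalfOpenIntegral.

(** * The integrand [fint]: reduction to the Beta kernel, monotonicity, integral bound *)

Section Integrand.
Variables (R : realType) (alpha sigma x : R) (N1 : nat).
Implicit Types (u v s t b : R).
Hypothesis aI : 0 < alpha < 1.
Hypothesis x0 : 0 < x.
Let T := Tend sigma alpha N1.

Lemma sin_alpha_pi_gt0 : 0 < sin (alpha * pi).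
Proof.
case/andP: aI => a0 a1.
by apply: sin_gt0_pi; rewrite mulr_gt0 ?pi_gt0//= gtr_pMl ?pi_gt0.
Qed.

(** The change of variable to the Beta integral: e^z = e^((sqrt u - T) / alpha) / x and dz = du / (2
    alpha sqrt u). *)
Definition zlog (u : R) : R := (Num.sqrt u - T) / alpha - ln x.

Lemma is_derive_zlog u : 0 < u ->
  is_derive u 1 zlog (2 * alpha * Num.sqrt u)^-1.
Proof.
move=> u0; have du := is_derive1_sqrt u0.
have d1 := is_derive1D (is_derive1Zl alpha^-1 du) (is_derive_cst (- T / alpha - ln x) u 1).
rewrite (_ : zlog = fun u => alpha^-1 * Num.sqrt u + (- T / alpha - ln x)); last first.
  by apply/funext => t; rewrite /zlog; ring.
by apply: (is_derive_eq d1); rewrite addr0 -invfM; congr (_^-1); ring.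
Qed.

(** With z = [zlog u], x^alpha e^(alpha z) = e^(sqrt u - T), and 1 / (1 + e^z) = x / (e^((sqrt u -
    T) / alpha) + x). *)
Lemma fint_beta_kernel u : fint sigma alpha N1 u x =
  sin (alpha * pi) / pi * x `^ alpha *
  (beta_kernel alpha 1 (zlog u) * (2 * alpha * Num.sqrt u)^-1).
Proof.
case/andP: aI => a0 a1.
have -> z : beta_kernel alpha 1 z = expR (alpha * z) / (1 + expR z).
  by rewrite /beta_kernel mul1r expRB expR_softplus.
rewrite /fint -/T.
have -> : alpha * zlog u = Num.sqrt u - T - alpha * ln x.
  by rewrite /zlog; field; lra.
rewrite (expRB (Num.sqrt u - T)).
have -> : expR (zlog u) = expR ((Num.sqrt u - T) / alpha) / x.
  by rewrite /zlog expRB lnK ?posrE.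
rewrite /powR gt_eqF//; set E := expR ((_ - T) / alpha); set F := expR (_ - T).
have E0 : 0 < E by exact: expR_gt0.
have L0 : 0 < expR (alpha * ln x) by exact: expR_gt0.
(* With this inverse abstracted, [field] does not ask for sqrt u != 0, so the identity covers every
   u under the convention 0^-1 = 0. *)
rewrite !invfM; move: (Num.sqrt u)^-1 => v.
move: (pi_gt0 R) (sin _); move: pi => p p0 S.
by field; rewrite !gt_eqF ?addr_gt0.
Qed.

Lemma continuous_fint u : 0 < u -> {for u, continuous (fint sigma alpha N1 ^~ x)}.
Proof.
move=> u0; case/andP: aI => a0 a1.
rewrite (_ : fint sigma alpha N1 ^~ x = fun u => sin (alpha * pi) / pi * x `^ alpha *
  (beta_kernel alpha 1 (zlog u) * (2 * alpha * Num.sqrt u)^-1)); last first.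
  by apply/funext => t; exact: fint_beta_kernel.
apply: cvgM; first exact: cvg_cst.
apply: cvgM.
  apply: (@continuous_comp _ _ _ zlog); last exact: continuous_beta_kernel.
  have [dz _] := is_derive_zlog u0.
  exact/differentiable_continuous/derivable1_diffP.
apply: cvgV; first by rewrite gt_eqF// !mulr_gt0// sqrtr_gt0.
by apply: cvgM; [exact: cvg_cst|exact: sqrt_continuous].
Qed.

Lemma fint_ge0 u : 0 <= fint sigma alpha N1 u x.
Proof.
case/andP: aI => a0 a1.
rewrite fint_beta_kernel !mulr_ge0 ?invr_ge0 ?mulr_ge0 ?sqrtr_ge0 ?powR_ge0 ?pi_ge0//.
- exact/ltW/sin_alpha_pi_gt0.
- exact/ltW/beta_kernel_gt0.
- exact: ltW.
Qed.

(* 1/f is, up to a constant, v (e^(k (v - T)) + x e^(-(v - T))) with v = sqrt u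
   and k = 1 / kappa; its derivative is nonnegative iff
   x (v - 1) <= (k v + 1) e^((v - T) / alpha). *)
Lemma fint_nonincreasing : x <= xstar sigma alpha N1 ->
  forall s t : R, 0 < s -> s <= t -> fint sigma alpha N1 t x <= fint sigma alpha N1 s x.
Proof.
move=> xx s t s0 st; case/andP: aI => a0 a1.
pose k := alpha^-1 - 1.
pose rho v := v * (expR (k * (v - T)) + x * expR (- (v - T))).
have rho0 v : 0 < v -> 0 < rho v.
  by move=> v0; rewrite mulr_gt0// addr_gt0 ?mulr_gt0 ?expR_gt0.
have fE u : 0 < u -> fint sigma alpha N1 u x =
    sin (alpha * pi) / (alpha * pi) * x / 2 / rho (Num.sqrt u).
  rewrite -sqrtr_gt0 /fint /rho -/T => v0.
  have -> : expR (k * (Num.sqrt u - T)) =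
      expR ((Num.sqrt u - T) / alpha) / expR (Num.sqrt u - T).
    by rewrite -expRN -expRD /k; congr expR; ring.
  rewrite expRN.
  have E0 := expR_gt0 ((Num.sqrt u - T) / alpha); have F0 := expR_gt0 (Num.sqrt u - T).
  have EF0 : 0 < expR ((Num.sqrt u - T) / alpha) + x by rewrite addr_gt0.
  move: (expR (_ / alpha)) (expR (Num.sqrt u - T)) E0 F0 EF0 => E F E0 F0 EF0.
  move: (pi_gt0 R) (sin _); move: pi => p p0 S.
  by field; rewrite !gt_eqF// divr_gt0.
rewrite !fE//; last exact: lt_le_trans st.
rewrite ler_wpM2l//.
  by rewrite !mulr_ge0 ?invr_ge0 ?mulr_ge0 ?pi_ge0 ?(ltW x0) ?(ltW a0) ?(ltW sin_alpha_pi_gt0).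
have vs0 : 0 < Num.sqrt s by rewrite sqrtr_gt0.
have vst : Num.sqrt s <= Num.sqrt t by rewrite ler_wsqrtr.
rewrite lef_pV2 ?posrE ?rho0//; last exact: lt_le_trans vst.
pose rho' v := expR (k * (v - T)) * (1 + k * v) + x * expR (- (v - T)) * (1 - v).
apply: (is_derive_ge0_le (g := rho')) => // v /andP[sv _]; have v0 := lt_le_trans vs0 sv.
  have d1 : is_derive v 1 (fun v => expR (k * (v - T))) (expR (k * (v - T)) * k).
    by apply: is_derive_eq; rewrite /GRing.scale/=; ring.
  have d2 : is_derive v 1 (fun v => expR (- (v - T))) (- expR (- (v - T))).
    by apply: is_derive_eq; rewrite /GRing.scale/=; ring.
  apply: (is_derive_eq (is_derive1M (is_derive_id v 1) (is_derive1D d1 (is_derive1Zl x d2)))).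
  by rewrite /rho'; ring.
have -> : rho' v = expR (- (v - T)) *
    (((alpha^-1 - 1) * v + 1) * expR ((v - T) / alpha) - x * (v - 1)).
  have -> : expR ((v - T) / alpha) = expR (k * (v - T)) * expR (v - T).
    by rewrite -expRD /k; congr expR; ring.
  rewrite /rho' expRN /k; field.
  by rewrite !gt_eqF ?expR_gt0.
rewrite mulr_ge0 ?expR_ge0// subr_ge0.
(* For v <= 1 the two sides have opposite signs; for v > 1, x is replaced by x* and [Cratio_min]
   applies. *)
have [v1|v1] := leP v 1.
  apply: (@le_trans _ _ 0); first by rewrite mulr_ge0_le0 ?(ltW x0)// subr_le0.
  by rewrite mulr_ge0 ?expR_ge0// addr_ge0// mulr_ge0// ?(ltW v0)// subr_ge0 invf_ge1// ltW.
apply: (@le_trans _ _ (xstar sigma alpha N1 * (v - 1))).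
  by rewrite ler_wpM2r// subr_ge0 ltW.
rewrite /xstar -/T.
have -> : expR ((v - T) / alpha) = expR ((v - Num.sqrt (ustar alpha)) / alpha) *
   expR ((Num.sqrt (ustar alpha) - T) / alpha).
  by rewrite -expRD; congr expR; ring.
rewrite mulrAC mulrA ler_wpM2r ?expR_ge0//; exact: Cratio_min.
Qed.

(** The same partial product bounds the sine and the Beta integral and cancels, leaving the factor
    (n + 1) / (n + 1 - alpha), which tends to 1. *)
Lemma fint_integral_le (b : R) : 0 < b ->
  (\int[lebesgue_measure]_(u in `]0%R, b]) (fint sigma alpha N1 u x)%:E
    <= (x `^ alpha)%:E)%E.
Proof.
move=> b0; case/andP: aI => a0 a1.
have key n : (\int[lebesgue_measure]_(u in `]0%R, b]) (fint sigma alpha N1 u x)%:E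
    <= (n.+1%:R / (n.+1%:R - alpha) * x `^ alpha)%:E)%E.
  have [G [g [dG cg hg GC]]] := beta_bounded1 aI n.
  set P := \prod_(1 <= k < n.+1) _ in GC.
  have P0 : 0 < P.
    rewrite /P big_nat prodr_gt0// => k /andP[k1 _].
    have {}k1 : 1 <= k%:R :> R by rewrite ler1n.
    rewrite subr_gt0 ltr_pdivrMr ?exprn_gt0 ?(lt_le_trans ltr01)// mul1r.
    by rewrite ltr_pXn2r ?nnegrE ?(ltW a0)// ?(le_trans ler01)// (lt_le_trans a1).
  set K := sin (alpha * pi) / pi * x `^ alpha.
  have K0 : 0 <= K.
    by rewrite !mulr_ge0 ?invr_ge0 ?powR_ge0 ?pi_ge0 ?(ltW sin_alpha_pi_gt0).
  have cdz u : 0 < u -> {for u, continuous (fun u => (2 * alpha * Num.sqrt u)^-1)}.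
    move=> u0; apply: cvgV; first by rewrite gt_eqF// !mulr_gt0// sqrtr_gt0.
    by apply: cvgM; [exact: cvg_cst|exact: sqrt_continuous].
  apply: (@integral_oc_le_antiderivative R (fint sigma alpha N1 ^~ x) _ _
    (fun u => K * (g (zlog u) * (2 * alpha * Num.sqrt u)^-1)) (fun u => K * G (zlog u))).
  - exact: continuous_fint.
  - by move=> u _; exact: fint_ge0.
  - exact: b0.
  - by move=> u u0; exact: (is_derive1Zl K (is_derive1_comp (dG (zlog u)) (is_derive_zlog u0))).
  - move=> u u0; apply: cvgM; first exact: cvg_cst.
    apply: cvgM; last exact: cdz.
    apply: (@continuous_comp _ _ _ zlog); last exact: cg.
    have [dz _] := is_derive_zlog u0.
    exact/differentiable_continuous/derivable1_diffP.
  - move=> u u0 /=; rewrite fint_beta_kernel -/K ler_wpM2l// ler_wpM2r//.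
    by rewrite invr_ge0 !mulr_ge0// ?sqrtr_ge0 ?ltW.
  - move=> s t s0 st; rewrite -mulrBr.
    have zst : zlog s <= zlog t.
      by rewrite /zlog lerD2r ler_wpM2r ?invr_ge0 ?(ltW a0)// lerD2r ler_wsqrtr.
    apply: le_trans (ler_wpM2l K0 (GC _ _ zst)) _.
    have n0 : 0 < n.+1%:R - alpha.
      by rewrite subr_gt0 (lt_le_trans a1)// ler1n.
    have sP := sin_le_prod n aI; rewrite -/P in sP.
    have q0 : 0 <= n.+1%:R / (n.+1%:R - alpha) by rewrite divr_ge0// ltW.
    (* Isolates the quotient that [sin_le_prod] bounds by 1. *)
    have -> : K * (n.+1%:R / (n.+1%:R - alpha) / (alpha * P)) =
        n.+1%:R / (n.+1%:R - alpha) * x `^ alpha * (sin (alpha * pi) / (alpha * pi * P)).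
      by rewrite /K; move: (n.+1%:R / _) => q; rewrite !invfM; ring.
    apply: ler_piMr; first by rewrite mulr_ge0 ?powR_ge0.
    rewrite ler_pdivrMr ?mul1r//.
    by rewrite !mulr_gt0 ?pi_gt0.
have I0 : (0 <= \int[lebesgue_measure]_(u in `]0%R, b]) (fint sigma alpha N1 u x)%:E)%E.
  by apply: integral_ge0 => u _; rewrite lee_fin fint_ge0.
case: (\int[_]_(_ in _) _)%E key I0 => [r||] key I0 //; last by have := key 0%N.
rewrite lee_fin leNgt; apply/negP => xr; set Y := x `^ alpha in key xr.
have r0 : 0 <= r by rewrite -lee_fin.
have rY : 0 < r - Y by rewrite subr_gt0.
(* With m = n + 1 > r / (r - Y), [key n] would give m (r - Y) <= alpha r <= r, a contradiction. *)
have := archi_boundP (divr_ge0 r0 (ltW rY)); set n := Num.bound _ => nr.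
have := key n; rewrite lee_fin.
have {}nr : r / (r - Y) < n.+1%:R by rewrite (lt_trans nr)// ltr_nat.
have n1 : 1 <= n.+1%:R :> R by rewrite ler1n.
move: nr n1; move: (n.+1%:R) => m; rewrite ltr_pdivrMr// => nr n1.
rewrite mulrAC ler_pdivlMr ?subr_gt0 ?(lt_le_trans a1)//.
by nra.
Qed.

End Integrand.

(** * Assembly of the quadrature error bounds *)

Section Error.
Variables (R : realType) (alpha sigma x : R) (N1 : nat).
Hypothesis aI : 0 < alpha < 1.
Hypothesis sigma0 : 0 < sigma.

Lemma hstep_gt0 : 0 < hstep sigma alpha.
Proof. by case/andP: aI => a0 _; rewrite mulr_gt0// exprn_gt0. Qed.

(** The argument of the ceiling is at least 1; hence the upper limit of integration is positive. *)
Lemma Nt_gt0 : (0 < Nt sigma alpha N1)%N.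
Proof.
rewrite /Nt absz_gt0 gt_eqF// ceil_gt0 ltr_wpDl// divr_ge0 ?(ltW hstep_gt0)//.
by rewrite mulr_ge0// sqr_ge0.
Qed.

(** The power alpha cancels the 1 / alpha in the exponent of [xstar], so the bound x^alpha becomes
    the stated one as x <= x*. *)
Lemma xstar_powR : xstar sigma alpha N1 `^ alpha = Ibound sigma alpha N1.
Proof.
case/andP: (aI) => a0 _.
rewrite /xstar /Ibound powRM ?expR_ge0 ?(ltW (Cratio_gt0 aI))//; congr (_ * _).
by rewrite /powR gt_eqF ?expR_gt0// expRK mulrC divfK// gt_eqF.
Qed.

Lemma quadrature_error_bounds : 0 <= x -> x <= xstar sigma alpha N1 ->
  [/\ (0 <= Iint sigma alpha N1 x - (Ssum sigma alpha N1 x)%:E)%E,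
      (Iint sigma alpha N1 x - (Ssum sigma alpha N1 x)%:E <= Iint sigma alpha N1 x)%E &
      (Iint sigma alpha N1 x <= (Ibound sigma alpha N1)%:E)%E].
Proof.
move=> x0 xx; have h0 := hstep_gt0; case/andP: (aI) => a0 _.
have b0 : 0 < (Nt sigma alpha N1)%:R * hstep sigma alpha by rewrite mulr_gt0// ltr0n Nt_gt0.
(* x = 0 is treated apart because [zlog] involves ln x; there the integrand is identically 0. *)
move: x0; rewrite le_eqVlt => /predU1P[x0|x0].
  have f0 u : fint sigma alpha N1 u x = 0 by rewrite /fint -x0 mul0r mul0r mulr0.
  have -> : Iint sigma alpha N1 x = 0%E by apply: integral0_eq => u _; rewrite f0.
  have -> : Ssum sigma alpha N1 x = 0.
    by rewrite /Ssum big1 ?mulr0// => j _; exact: f0.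
  by rewrite sube0; split=> //; rewrite lee_fin -xstar_powR powR_ge0.
split.
- rewrite sube_ge0//; apply: nonincreasing_sum_le_integral => //.
  + exact: continuous_fint.
  + by move=> u _; exact: fint_ge0.
  + exact: fint_nonincreasing.
- rewrite leeBlDr// leeDl// lee_fin mulr_ge0 ?(ltW h0)//.
  by apply: sumr_ge0 => j _; exact: fint_ge0.
- apply: le_trans (fint_integral_le sigma N1 aI x0 b0) _.
  by rewrite lee_fin -xstar_powR ge0_ler_powR ?nnegrE ?(ltW a0) ?(ltW x0)// (le_trans (ltW x0)).
Qed.
End Error.

Theorem theorem3p3 (R : realType) :
  (forall (alpha sigma : R) (N1 : nat) (x : R),
      0 < alpha -> alpha < 1 -> 0 < sigma -> (0 < N1)%N ->
      0 <= x -> x <= 1 -> x <= xstar sigma alpha N1 ->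
      (0 <= Iint sigma alpha N1 x - (Ssum sigma alpha N1 x)%:E
       /\ Iint sigma alpha N1 x - (Ssum sigma alpha N1 x)%:E <= Iint sigma alpha N1 x
       /\ Iint sigma alpha N1 x <= (Ibound sigma alpha N1)%:E)%E)
  /\ {in `]0, 1[ &, {homo (@ustar R) : a b / a < b}}
  /\ (forall alpha : R, 0 < alpha < 1 -> 1 < ustar alpha < 4)
  /\ (exists M : R, forall alpha : R, 0 < alpha < 1 ->
        `|(Cratio alpha) `^ alpha * expR (Num.sqrt (ustar alpha))| <= M).
Proof.
split; last split; last split.
- move=> alpha sigma N1 x a0 a1 s0 _ x0 _ xx.
  have aI : 0 < alpha < 1 by rewrite a0.
  by have [] := quadrature_error_bounds aI s0 x0 xx.
- exact: ustar_increasing.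
- exact: ustar_bounds.
- by exists (expR 6); exact: Cratio_powR_le.
Qed.
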